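(* Suppose that the choice of coefficients $c$ is symmetric. Let $M$ be an object in $\mathcal X$. Then there exists a non-degenerate contravariant form on $M$.
   Context: $R$ is a root system with basis $\Pi$ and weight lattice $X$. The partial order on $X$ is: $\mu\le\lambda$ iff $\lambda-\mu$ is a (possibly empty) sum of elements of $\Pi$. A subset $T\subset X$ is quasi-bounded (from above) if for all $\mu\in X$ the set $\{\lambda\in T\mid \mu\le\lambda\}$ is finite. $K$ is a field. A choice of coefficients, fixed throughout, is a map $c\colon X\times\Pi\times\mathbb Z_{\ge0}^2\times\mathbb Z\to K$, $(\mu,\alpha,m,n,r)\mapsto c_{\mu,\alpha,m,n,r}$, with $c_{\mu,\alpha,m,n,0}=1$ and $c_{\mu,\alpha,m,n,r}=0$ for $r<0$. It is symmetric if $c_{\mu,\alpha,m,n,r}=c_{\mu,\alpha,n,m,r}$ for all $\mu\in X$, $\alpha\in\Pi$, $m,n>0$, $r\in\mathbb Z$. The category $\mathcal X$: objects are $X$-graded $K$-vector spaces $M=\bigoplus_{\mu\in X}M_\mu$ with $K$-linear operators $E_{\alpha,n}=E_{\mu,\alpha,n}\colon M_\mu\to M_{\mu+n\alpha}$ and $F_{\alpha,n}=F_{\mu,\alpha,n}\colon M_{\mu+n\alpha}\to M_\mu$ for all $\mu\in X$, $\alpha\in\Pi$, $n>0$ (with $E_{\mu,\alpha,0}=F_{\mu,\alpha,0}=\operatorname{id}_{M_\mu}$ and $E_{\mu,\alpha,n}=F_{\mu,\alpha,n}=0$ for $n<0$), such that: (X1) The set of $\mu$ with $M_\mu\ne0$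 is quasi-bounded from above and each $M_\mu$ is finite dimensional. (X2) For all $\mu\in X$, $\alpha,\beta\in\Pi$, $m,n>0$ and $v\in M_{\mu+n\beta}$: $E_{\alpha,m}F_{\beta,n}(v)=F_{\beta,n}E_{\alpha,m}(v)$ if $\alpha\neq\beta$, and $E_{\alpha,m}F_{\alpha,n}(v)=\sum_{r\in\mathbb Z}c_{\mu,\alpha,m,n,r}F_{\alpha,n-r}E_{\alpha,m-r}(v)$ if $\alpha=\beta$. (X3) For all $\mu\in X$: $M_\mu=\ker E_\mu\oplus\operatorname{im}F_\mu$, where $M_{\delta\mu}:=\bigoplus_{\alpha\in\Pi,n>0}M_{\mu+n\alpha}$, $E_\mu\colon M_\mu\to M_{\delta\mu}$ has components $E_{\mu,\alpha,n}$, and $F_\mu\colon M_{\delta\mu}\to M_\mu$ is $(v_{\mu+n\alpha})\mapsto\sum_{\alpha,n}F_{\mu,\alpha,n}(v_{\mu+n\alpha})$. Morphisms are grading-preserving $K$-linear maps commuting with all $E$- and $F$-operators. A contravariant form on an object $M$ of $\mathcal X$ is a bilinear form $b\colon M\times M\to K$ such that: (1) $b$ is symmetric; (2) $b(v,w)=0$ for $v\in M_\lambda$, $w\in M_\mu$ with $\lambda\neq\mu$; (3) $b(E_{\alpha,n}(v),w)=b(v,F_{\alpha,n}(w))$ for all $\mu\in X$, $\alpha\in\Pi$, $n>0$, $v\in M_\mu$, $w\in M_{\mu+n\alpha}$. *)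

(* Defs.v *)
From HB Require Import structures.
From mathcomp Require Import all_boot all_order all_algebra sesquilinear.
From mathcomp Require Import boolp classical_sets functions cardinality fsbigop.

Set Implicit Arguments.
Unset Strict Implicit.
Unset Printing Implicit Defensive.

Import Order.TTheory GRing.Theory Num.Theory.
Local Open Scope classical_set_scope.
Local Open Scope ring_scope.

Section RootSystem.
Variables (F : archiRealFieldType) (V : vectType F).

(* Bourbaki, Lie VI.1.1, where a root system need not be reduced.
   [coroot] is only meaningful on roots, where the axioms determine it. *)
Record rootSystem := RootSystem {
  roots : seq V;
  coroot : V -> {scalar V};
  roots_span : <<roots>>%VS = fullv;
  roots_neq0 : 0 \notin roots;
  coroot_root : {in roots, forall a, coroot a a = 2};
  refl_root : {in roots &, forall a b, b - coroot a b *: a \in roots};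
  coroot_int : {in roots &, forall a b, coroot a b \is a Num.int}
}.

Record rootBasis (R : rootSystem) := RootBasis {
  simple : seq V;
  simple_roots : {subset simple <= roots R};
  simple_basis : basis_of fullv simple;
  root_pos_neg : {in roots R, forall b, exists n : seq_sub simple -> nat,
    b = \sum_a ssval a *+ n a \/ b = - \sum_a ssval a *+ n a}
}.

Definition is_weight (R : rootSystem) : {pred V} :=
  [pred x | all (fun a => coroot R a x \is a Num.int) (roots R)].

Fact is_weight_zmod_closed (R : rootSystem) : zmod_closed (is_weight R).
Proof.
split=> [|x y /allP Hx /allP Hy].
  by apply/allP => a _; rewrite raddf0 rpred0.
by apply/allP => a Ha; rewrite raddfB rpredB ?Hx ?Hy.
Qed.

HB.instance Definition _ (R : rootSystem) :=
  GRing.isZmodClosed.Build V (is_weight R) (is_weight_zmod_closed R).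

Record weight (R : rootSystem) :=
  Weight { weight_val : V; weightP : weight_val \in is_weight R }.

HB.instance Definition _ (R : rootSystem) := [isSub for @weight_val R].
HB.instance Definition _ (R : rootSystem) := [Choice of weight R by <:].
HB.instance Definition _ (R : rootSystem) :=
  [SubChoice_isSubZmodule of weight R by <:].

Variables (R : rootSystem) (Pi : rootBasis R).

Local Notation simpleRoot := (seq_sub (simple Pi)).

Fact simple_is_weight (a : simpleRoot) : ssval a \in is_weight R.
Proof.
by apply/allP => b Hb; apply: coroot_int => //; apply/simple_roots/ssvalP.
Qed.

Definition simple_weight (a : simpleRoot) : weight R :=
  Weight (simple_is_weight a).

Definition weight_le (mu la : weight R) : Prop :=
  exists n : simpleRoot -> nat, la - mu = \sum_a simple_weight a *+ n a.

Definition quasi_bounded (T : set (weight R)) : Prop :=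
  forall mu, finite_set [set la | T la /\ weight_le mu la].

Variable K : fieldType.

Record coefficients := Coefficients {
  coef :> weight R -> simpleRoot -> nat -> nat -> int -> K;
  coef_r0 : forall mu a (m n : nat), coef mu a m n 0 = 1;
  coef_rlt0 : forall mu a m n (r : int), r < 0 -> coef mu a m n r = 0
}.

Definition symmetric_coef (c : coefficients) : Prop :=
  forall mu a (m n : nat) (r : int), (0 < m)%N -> (0 < n)%N ->
    c mu a m n r = c mu a n m r.

(* The graded space is given as an internal direct sum, and the operators
   E_{mu,a,n}, for all mu together, as one endomorphism [opE a n] of the whole
   space; [opE_degree] and [opF_degree] say that it has the right components. *)
Record gradedSpace := GradedSpace {
  carrier :> lmodType K;
  component : weight R -> {pred carrier};
  component_submod : forall mu, submod_closed (component mu);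
  component_direct : forall v : carrier, exists! x : weight R -> carrier,
    [/\ forall mu, x mu \in component mu,
        finite_set [set mu | x mu != 0]
      & v = \sum_(mu \in [set: weight R]) x mu];
  opE : simpleRoot -> int -> {linear carrier -> carrier};
  opF : simpleRoot -> int -> {linear carrier -> carrier};
  opE_degree : forall (mu : weight R) a (n : nat) v, (0 < n)%N ->
    v \in component mu -> opE a n v \in component (mu + simple_weight a *+ n);
  opF_degree : forall (mu : weight R) a (n : nat) v, (0 < n)%N ->
    v \in component (mu + simple_weight a *+ n) -> opF a n v \in component mu;
  opE0 : forall a v, opE a 0 v = v;
  opF0 : forall a v, opF a 0 v = v;
  opE_lt0 : forall a (n : int) v, n < 0 -> opE a n v = 0;
  opF_lt0 : forall a (n : int) v, n < 0 -> opF a n v = 0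
}.

Arguments component : clear implicits.

Section Objects.
Variables (c : coefficients) (M : gradedSpace).

Definition finite_dim (mu : weight R) : Prop :=
  exists2 s : seq M, {subset s <= component M mu} &
    forall v, v \in component M mu ->
      exists k : 'I_(size s) -> K, v = \sum_i k i *: s`_i.

Definition condX1 : Prop :=
  quasi_bounded [set mu : weight R | exists2 v, v \in component M mu & v != 0] /\
  forall mu, finite_dim mu.

Definition condX2 : Prop :=
  forall (mu : weight R) (a b : simpleRoot) (m n : nat) (v : M),
    (0 < m)%N -> (0 < n)%N -> v \in component M (mu + simple_weight b *+ n) ->
    (a != b -> opE M a m (opF M b n v) = opF M b n (opE M a m v)) /\
    (a = b -> opE M a m (opF M a n v) =
       \sum_(r \in [set: int])
         c mu a m n r *: opF M a (n%:Z - r) (opE M a (m%:Z - r) v)).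

(* Elements of M_{delta mu}, as finitely supported families; the pair (a, n)
   indexes the summand M_{mu + n a}, and only the pairs with n > 0 matter. *)
Definition delta_space (mu : weight R) : set (simpleRoot * nat -> M) :=
  [set w | (forall p, (0 < p.2)%N ->
              w p \in component M (mu + simple_weight p.1 *+ p.2)) /\
           finite_set [set p | (0 < p.2)%N /\ w p != 0]].

Definition kerE (mu : weight R) : set M :=
  [set v | v \in component M mu /\
     forall (a : simpleRoot) (n : nat), (0 < n)%N -> opE M a n v = 0].

Definition mapF (w : simpleRoot * nat -> M) : M :=
  \sum_(p \in [set p : simpleRoot * nat | (0 < p.2)%N]) opF M p.1 p.2 (w p).

Definition imF (mu : weight R) : set M := mapF @` delta_space mu.

Definition condX3 : Prop :=
  forall mu,
    [set v | v \in component M mu] = [set u + w | u in kerE mu & w in imF mu] /\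
    kerE mu `&` imF mu = [set 0].

End Objects.

Record objX (c : coefficients) := ObjX {
  objX_space :> gradedSpace;
  objX1 : condX1 objX_space;
  objX2 : condX2 c objX_space;
  objX3 : condX3 objX_space
}.

Definition contravariant (M : gradedSpace) (b : {biscalar M}) : Prop :=
  [/\ forall v w, b v w = b w v,
      forall la mu v w, v \in component M la -> w \in component M mu -> la != mu ->
        b v w = 0
    & forall mu (a : simpleRoot) (n : nat) v w, (0 < n)%N ->
        v \in component M mu -> w \in component M (mu + simple_weight a *+ n) ->
        b (opE M a n v) w = b v (opF M a n w)].

Definition nondegenerate_form (M : lmodType K) (b : {biscalar M}) : Prop :=
  (forall v, (forall w, b v w = 0) -> v = 0) /\
  (forall w, (forall v, b v w = 0) -> w = 0).

End RootSystem.

(* Main.v *)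
Require Import Defs.
From HB Require Import structures.
From mathcomp Require Import all_boot all_order all_algebra finmap sesquilinear.
From mathcomp Require Import boolp classical_sets cardinality fsbigop.

(** The weights above a given one that occur in M are finite in number, so a
    form can be built on M_mu by induction from above, once it is known on all
    M_{mu + n a} with n > 0.

    By (X3), M_mu = ker E_mu + im F_mu, a direct sum. Contravariance forces the
    two summands to be orthogonal, puts no condition on ker E_mu, and forces
    (F_mu x, F_mu y) = (x, E_mu F_mu y) on im F_mu, where the right side uses the
    orthogonal sum of the forms already known on the summands of M_{delta mu}.
    On ker E_mu any nondegenerate symmetric form will do
    ([ex_nondegenerate_sym]). On im F_mu the formula is well defined and
    symmetric as soon as E_mu F_mu is self-adjoint on M_{delta mu}. That is where
    (X2) and the symmetry of the coefficients enter ([form_opEF]): the relation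
    rewrites E F as a combination of operators F E, and each F E only passes
    through weights above mu, where contravariance is known.

    Instead of checking that a form on im F_mu is well defined, the construction
    fixes an arbitrary preimage s(v) of the im F_mu component of v and puts
    (v, w) = kap(v', w') + (s(v), E_mu w), with v' and w' the components in
    ker E_mu and kap the form chosen there. Linearity in w is clear;
    contravariance follows from self-adjointness ([step_adj]), then symmetry
    ([step_sym]), hence linearity in v, and finally nondegeneracy
    ([step_nondeg]): a vector orthogonal to im F_mu is killed by all E, so lies
    in ker E_mu, and kap is nondegenerate.

    The form on M is the orthogonal sum of the forms on the weight spaces. *)

Set Implicit Arguments.
Unset Strict Implicit.
Unset Printing Implicit Defensive.

Import Order.TTheory GRing.Theory Num.Theory.
Local Open Scope classical_set_scope.
Local Open Scope ring_scope.

(** * Linear maps relative to a subspace; nondegenerate forms *)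

Section LinearOnSubmodules.
Variables (K : fieldType) (U : lmodType K).

(** The forms below are only additive inside one weight space, and the subspaces
    that occur (weight spaces, kernels, images) are plain classical sets, so
    linearity is formulated relative to a set closed under linear combinations. *)
Definition submod_set (S : set U) : Prop :=
  S 0 /\ forall a x y, S x -> S y -> S (a *: x + y).

Definition linear_on (S : set U) (W : lmodType K) (h : U -> W) : Prop :=
  forall a x y, S x -> S y -> h (a *: x + y) = a *: h x + h y.

Section Submodule.
Variables (S : set U) (Ssub : submod_set S).

Lemma submod_setZ a x : S x -> S (a *: x).
Proof.
by move=> Sx; rewrite -[a *: x]addr0; apply: Ssub.2 => //; exact: Ssub.1.
Qed.

Lemma submod_setB x y : S x -> S y -> S (x - y).
Proof. by move=> Sx Sy; rewrite addrC -scaleN1r; apply: Ssub.2. Qed.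

Variables (W : lmodType K) (h : U -> W) (h_lin : linear_on S h).

Lemma linear_on0 : h 0 = 0.
Proof.
have := h_lin (-1) Ssub.1 Ssub.1.
by rewrite scaler0 addr0 scaleN1r addNr.
Qed.

Lemma linear_onZ a x : S x -> h (a *: x) = a *: h x.
Proof.
by move=> Sx; rewrite -[a *: x]addr0 h_lin ?linear_on0 ?addr0//; exact: Ssub.1.
Qed.

Lemma linear_on_sum I (r : seq I) (P : pred I) (f : I -> U) :
  (forall i, P i -> S (f i)) ->
  S (\sum_(i <- r | P i) f i) /\
  h (\sum_(i <- r | P i) f i) = \sum_(i <- r | P i) h (f i).
Proof.
move=> Sf; elim/big_rec2: _ => [|i y x Pi [Sx <-]].
  by split; [exact: Ssub.1 | exact: linear_on0].
rewrite -[f i]scale1r; split; first by apply: Ssub.2 => //; exact: Sf.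
by rewrite h_lin ?scale1r//; exact: Sf.
Qed.

(** Finiteness of the support of [f] matters: the sum of a family with infinite
    support is 0 by convention, and [h] could make the support finite. *)
Lemma linear_on_fsum (I : choiceType) (P : set I) (f : I -> U) :
  (forall i, P i -> S (f i)) -> finite_set [set i | P i /\ f i != 0] ->
  S (\sum_(i \in P) f i) /\ h (\sum_(i \in P) f i) = \sum_(i \in P) h (f i).
Proof.
move=> Sf fin; set r : seq I := fset_set [set i | P i /\ f i != 0].
have rP : [set` r] `<=` P.
  by move=> i /=; rewrite in_fset_set// inE => -[].
have f0 i : P i -> i \notin r -> f i = 0.
  rewrite in_fset_set// notin_setE => Pi /not_andP[//|/negP].
  by rewrite negbK => /eqP.
rewrite !(fsbigE r _ (fset_uniq _) rP).
- by apply: linear_on_sum => i /set_mem /Sf.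
- by move=> i Pi /(f0 i Pi) ->; exact: linear_on0.
- exact: f0.
Qed.

End Submodule.

Lemma fsum_lin (I : choiceType) (P : set I) (f g : I -> U) a :
  finite_set [set i | P i /\ f i != 0] ->
  finite_set [set i | P i /\ g i != 0] ->
  \sum_(i \in P) (a *: f i + g i) =
    a *: (\sum_(i \in P) f i) + \sum_(i \in P) g i.
Proof.
move=> finf fing.
set A := [set i | P i /\ f i != 0] `|` [set i | P i /\ g i != 0].
have finA : finite_set A by rewrite finite_setU.
set r : seq I := fset_set A.
have rP : [set` r] `<=` P.
  by move=> i /=; rewrite in_fset_set// inE => -[] [].
have fg0 i : P i -> i \notin r -> f i = 0 /\ g i = 0.
  rewrite in_fset_set// notin_setE => Pi /not_orP[] /not_andP[//|/negP].
  rewrite negbK => /eqP -> /not_andP[//|/negP].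
  by rewrite negbK => /eqP ->.
have ru : uniq r by exact: fset_uniq.
rewrite !(fsbigE r _ ru rP).
- by rewrite scaler_sumr -big_split.
- by move=> i Pi /(fg0 i Pi)[].
- by move=> i Pi /(fg0 i Pi)[].
by move=> i Pi /(fg0 i Pi)[-> ->]; rewrite scaler0 addr0.
Qed.

(** The dot product in coordinates with respect to a basis. The basis is reached
    by induction on the size of a spanning family: a family with a nontrivial
    relation spans the same space without one of its members. Over an arbitrary
    field the dot product can have isotropic vectors, but it is still
    nondegenerate since pairing with the basis vectors returns the
    coordinates. *)
Lemma ex_nondegenerate_sym n (f : 'I_n -> U) (S : set U) :
    submod_set S -> (forall i, S (f i)) ->
    (forall v, S v -> exists k, v = \sum_i k i *: f i) ->
  exists b : U -> U -> K,
    [/\ forall u v, b u v = b v u,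
        forall u, linear_on S (b u : U -> K^o)
      & forall u, S u -> (forall v, S v -> b u v = 0) -> u = 0].
Proof.
move=> Ssub; elim: n f => [|n IHn] f Sf span.
  exists (fun _ _ => 0); split=> //.
    by move=> u a x y _ _; rewrite scaler0 addr0.
  by move=> u /span[k ->] _; rewrite big_ord0.
have [[k [k0 [j kj]]]|indep] := pselect
  (exists k, \sum_i k i *: f i = 0 /\ exists j, k j != 0).
  apply: (IHn (f \o lift j)) => [i|v /span[l ->]]; first exact: Sf.
  have fj : f j = - \sum_i (k j)^-1 *: (k (lift j i) *: f (lift j i)).
    move: k0; rewrite (bigD1_ord j)//= => /eqP; rewrite addr_eq0 => /eqP k0.
    by rewrite -scaler_sumr -scalerN -k0 scalerA mulVf// scale1r.
  (* The coordinates of v after [f j] is eliminated through the relation k. *)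
  exists (fun i => l (lift j i) - l j * (k j)^-1 * k (lift j i)).
  rewrite (bigD1_ord j)//= {1}fj scalerN scaler_sumr -sumrN -big_split /=.
  apply: eq_bigr => i _.
  by rewrite !scalerA addrC -scalerBl.
have [c cP] : {c : U -> 'I_n.+1 -> K &
    forall v, S v -> v = \sum_i c v i *: f i}.
  apply: (choice (P := fun v k => S v -> v = \sum_i k i *: f i)) => v.
  have [/span[k kv]|nSv] := pselect (S v); first by exists k.
  by exists (fun=> 0).
have coord_eq k l : \sum_i k i *: f i = \sum_i l i *: f i -> k =1 l.
  move=> kl j; apply/eqP; rewrite -subr_eq0; apply/negPn/negP => klj.
  apply: indep; exists (fun i => k i - l i); split; last by exists j.
  under eq_bigr do rewrite scalerBl.
  by rewrite sumrB kl subrr.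
exists (fun u v => \sum_i c u i * c v i); split=> [u v|u a x y Sx Sy|u Su u0].
- by apply: eq_bigr => i _; rewrite mulrC.
- have cxy i : c (a *: x + y) i = a * c x i + c y i.
    move: i; apply: coord_eq.
    rewrite -cP; last exact: Ssub.2.
    under eq_bigr do rewrite scalerDl -scalerA.
    by rewrite big_split -scaler_sumr /= -!cP.
  rewrite scaler_sumr -big_split; apply: eq_bigr => i _ /=.
  by rewrite cxy mulrDr mulrCA.
- rewrite (cP u)// big1// => j _; suff -> : c u j = 0 by rewrite scale0r.
  have cf i : c (f j) i = (i == j)%:R.
    move: i; apply: coord_eq; rewrite -cP//.
    rewrite (bigD1 j)//= eqxx scale1r big1 ?addr0// => i /negPf ->.
    by rewrite scale0r.
  move: (u0 _ (Sf j)); rewrite (bigD1 j)//= cf eqxx mulr1 big1 ?addr0//.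
  by move=> i /negPf; rewrite cf => ->; rewrite mulr0.
Qed.

End LinearOnSubmodules.

(** * The order on weights and the depth of a weight *)

Section Weights.
Variables (F : archiRealFieldType) (V : vectType F).
Variables (R : rootSystem V) (Pi : rootBasis R).

Local Notation simpleRoot := (seq_sub (simple Pi)).

(** A pair [p = (a, n)] is the index of the operators E_{a,n} and F_{a,n}, which
    go from weight [mu] to weight [raise mu p] and back. *)
Definition raise (mu : weight R) (p : simpleRoot * nat) : weight R :=
  mu + simple_weight p.1 *+ p.2.

Lemma raiseAC mu p q : raise (raise mu p) q = raise (raise mu q) p.
Proof. exact: addrAC. Qed.

Lemma weight_val_sum (n : simpleRoot -> nat) :
  weight_val (\sum_a simple_weight a *+ n a) = \sum_a ssval a *+ n a :> V.
Proof.
rewrite -[LHS]/(val _) raddf_sum; apply: eq_bigr => a _.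
by rewrite raddfMn.
Qed.

(** The linear form with value 1 on every simple root. It shows that a nonempty
    sum of simple roots is not 0, i.e. that the order on weights is
    antisymmetric. *)
Definition height (v : V) : F :=
  \sum_i coord (in_tuple (simple Pi)) i v.

Lemma height_sum (n : simpleRoot -> nat) :
  height (\sum_a ssval a *+ n a) = (\sum_a n a)%:R.
Proof.
set X := in_tuple (simple Pi).
have freeX : free X by rewrite (basis_free (simple_basis Pi)).
have height1 (a : simpleRoot) : \sum_i coord X i (ssval a) = 1.
  have [j ->] : exists j : 'I_(size (simple Pi)), ssval a = X`_j.
    have lt_a : (index (ssval a) (simple Pi) < size (simple Pi))%N.
      by rewrite index_mem ssvalP.
    by exists (Ordinal lt_a); rewrite /= nth_index ?ssvalP.
  rewrite (bigD1 j)//= coord_free// eqxx big1 ?addr0// => i ij.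
  by rewrite coord_free// eq_sym (negPf ij).
rewrite /height natr_sum.
transitivity (\sum_i \sum_a coord X i (ssval a) *+ n a).
  apply: eq_bigr => i _; rewrite raddf_sum.
  by apply: eq_bigr => a _; rewrite raddfMn.
by rewrite exchange_big; apply: eq_bigr => a _; rewrite sumrMnl height1.
Qed.

Lemma sub_raise mu p la (n : simpleRoot -> nat) :
  la - raise mu p = \sum_a simple_weight a *+ n a ->
  la - mu = \sum_a simple_weight a *+ (n a + (a == p.1) * p.2)%N.
Proof.
move=> nE; under eq_bigr do rewrite mulrnDr.
rewrite big_split /= -nE (bigD1 p.1)//= eqxx mul1n [X in _ + (_ + X)]big1.
  by rewrite addr0 /raise opprD addrA subrK.
by move=> a /negPf ->.
Qed.

Lemma weight_le_raise mu p la :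
  weight_le Pi (raise mu p) la -> weight_le Pi mu la.
Proof. by move=> [n /sub_raise nE]; eexists; exact: nE. Qed.

Lemma weight_le_refl (mu : weight R) : weight_le Pi mu mu.
Proof. by exists (fun=> 0%N); rewrite subrr big1// => a _; rewrite mulr0n. Qed.

Lemma raise_nle mu p : (0 < p.2)%N -> ~ weight_le Pi (raise mu p) mu.
Proof.
move=> p_gt0 [n /sub_raise]; rewrite subrr => m0.
pose m a := (n a + (a == p.1) * p.2)%N.
have := height_sum m; rewrite -weight_val_sum -m0 /height big1.
  move=> /esym /eqP; rewrite pnatr_eq0 sum_nat_eq0 => /forallP/(_ p.1)/=.
  by rewrite /m eqxx mul1n addn_eq0 (gtn_eqF p_gt0) andbF.
by move=> i _; rewrite (raddf0 (coord _ i)).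
Qed.

End Weights.

Lemma ltn_measure_wf (T : Type) (f : T -> nat) :
  well_founded (fun x y => f x < f y)%N.
Proof.
move=> y; have [n] := ubnP (f y); elim: n y => [y|n IHn y].
  by rewrite ltn0.
rewrite ltnS => le_n; constructor => x lt_xy; apply: IHn.
exact: leq_trans lt_xy le_n.
Qed.

Section Depth.
Variables (F : archiRealFieldType) (V : vectType F).
Variables (R : rootSystem V) (Pi : rootBasis R) (K : fieldType).
Variable M : gradedSpace Pi K.

Definition weight_space (mu : weight R) : set M := [set v | v \in component mu].

Definition in_support (mu : weight R) : Prop :=
  exists2 v, weight_space mu v & v != 0.

Lemma not_in_support mu v : ~ in_support mu -> weight_space mu v -> v = 0.
Proof.
by move=> nsmu vmu; apply/eqP/negPn/negP => v0; apply: nsmu; exists v.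
Qed.

(** The induction measure. Quasi-boundedness makes the set finite, and going up
    from a weight of the support strictly decreases its size. From a weight
    outside the support the depth can remain constant, which is why several
    statements below have to single out such weights. *)
Definition depth (mu : weight R) : nat :=
  #|` fset_set [set la | in_support la /\ weight_le Pi mu la] |.

Hypothesis M_qb : quasi_bounded Pi in_support.

Lemma depth_raise_le mu (p : seq_sub (simple Pi) * nat) :
  (depth (raise mu p) <= depth mu)%N.
Proof.
apply: fsubset_leq_card; rewrite -fset_set_sub; try exact: M_qb.
by move=> la [sla /weight_le_raise lela].
Qed.

Lemma depth_raise_lt mu (p : seq_sub (simple Pi) * nat) :
  in_support mu -> (0 < p.2)%N ->
  (depth (raise mu p) < depth mu)%N.
Proof.
move=> smu p_gt0; apply: fproper_ltn_card; rewrite fproperEneq.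
apply/andP; split.
  apply/eqP => /(congr1 (fun A : {fset _} => mu \in A)).
  rewrite !in_fset_set; try exact: M_qb.
  rewrite [RHS]mem_set; last by split=> //; exact: weight_le_refl.
  by move=> /set_mem [_]; exact: raise_nle.
rewrite -fset_set_sub; try exact: M_qb.
by move=> la [sla /weight_le_raise lela].
Qed.

End Depth.

(** * The operators E and F on weight spaces *)

Section GradedOperators.
Variables (F : archiRealFieldType) (V : vectType F).
Variables (R : rootSystem V) (Pi : rootBasis R) (K : fieldType).
Variables (c : coefficients Pi K) (M : gradedSpace Pi K).
Hypotheses (M_X2 : condX2 c M) (M_X3 : condX3 M).

Local Notation simpleRoot := (seq_sub (simple Pi)).
Local Notation ws := (@weight_space _ _ _ Pi K M).
Local Notation Eo p := (opE M p.1 p.2%:Z).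
Local Notation Fo p := (opF M p.1 p.2%:Z).

Lemma weight_space_submod mu : submod_set (ws mu).
Proof. by have [] := component_submod M mu; split. Qed.

Lemma opE_raise mu p v : ws mu v -> ws (raise mu p) (Eo p v).
Proof.
case: p => a [|n] vmu; last exact: opE_degree.
by rewrite /raise mulr0n addr0 opE0.
Qed.

Lemma opF_raise mu p v : ws (raise mu p) v -> ws mu (Fo p v).
Proof.
case: p => a [|n] vmu; last by apply: opF_degree vmu.
by move: vmu; rewrite /raise mulr0n addr0 opF0.
Qed.

(** Relation (X2) as a sum over an ordinal. Terms with [k > m] or [k > n] vanish
    because operators of negative index are 0, terms with [k < 0] because their
    coefficient is 0. *)
Lemma opEF_same mu a m n v : (0 < m)%N -> (0 < n)%N -> ws (raise mu (a, n)) v ->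
  opE M a m (opF M a n v) = \sum_(k < (minn m n).+1)
    c mu a m n k *: opF M a (n - k)%N (opE M a (m - k)%N v).
Proof.
move=> m_gt0 n_gt0 vn; have [_ ->//] := M_X2 a m_gt0 n_gt0 vn.
pose r : seq int := map Posz (iota 0 (minn m n).+1).
rewrite (fsbigE r) //; first last.
- case=> k _; last by rewrite coef_rlt0// scale0r.
  rewrite mem_map; last by move=> ? ? [].
  rewrite mem_iota add0n ltnS /= leq_min negb_and -!ltnNge => /orP[] lt_k.
    by rewrite opE_lt0 ?linear0 ?scaler0// subr_lt0 ltz_nat.
  by rewrite opF_lt0 ?scaler0// subr_lt0 ltz_nat.
- by rewrite map_inj_uniq ?iota_uniq// => ? ? [].
under eq_bigl do rewrite in_setT.
rewrite big_map -[iota 0 _]/(index_iota 0 (minn m n).+1) big_mkord.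
apply: eq_bigr => k _; have := ltn_ord k; rewrite ltnS leq_min => /andP[km kn].
by rewrite !subzn.
Qed.

Lemma delta_space_lin mu (x y : simpleRoot * nat -> M) (a : K) :
  delta_space mu x -> delta_space mu y ->
  delta_space mu (fun p => a *: x p + y p).
Proof.
move=> [xmu xfin] [ymu yfin]; split=> [p p_gt0|].
  by apply: (weight_space_submod _).2; [exact: xmu | exact: ymu].
have := conj xfin yfin; rewrite -finite_setU; apply: sub_finite_set.
move=> p [p_gt0 xyp]; have [xp0|xp0] := eqVneq (x p) 0; [right|by left].
by split=> //; move: xyp; rewrite xp0 scaler0 add0r.
Qed.

Lemma finite_opF mu (x : simpleRoot * nat -> M) : delta_space mu x ->
  finite_set [set p : simpleRoot * nat | (0 < p.2)%N /\ Fo p (x p) != 0].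
Proof.
move=> [_]; apply: sub_finite_set => p [p_gt0 Fp0]; split=> //.
by apply: contra_neq Fp0 => ->; rewrite linear0.
Qed.

Lemma mapF_lin mu (x y : simpleRoot * nat -> M) (a : K) :
  delta_space mu x -> delta_space mu y ->
  mapF (fun p => a *: x p + y p) = a *: mapF x + mapF y.
Proof.
move=> dx dy; rewrite /mapF -fsum_lin;
  [|exact: (finite_opF dx)|exact: (finite_opF dy)].
by apply: eq_fsbigr => p _; rewrite linearP.
Qed.

Lemma imF_submod mu : submod_set (imF mu : set M).
Proof.
split=> [|a x y [x' dx <-] [y' dy <-]].
  have d0 : delta_space mu (fun=> 0 : M).
    split=> [p _|]; first exact: (weight_space_submod _).1.
    by apply: (sub_finite_set (B := set0)) => // p [_]; rewrite eqxx.
  exists (fun=> 0) => //.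
  by rewrite /mapF fsbig1// => p _; rewrite linear0.
exists (fun p => a *: x' p + y' p); first exact: delta_space_lin.
exact: mapF_lin dx dy.
Qed.

Lemma opF_imF mu p v : (0 < p.2)%N -> ws (raise mu p) v -> imF mu (Fo p v).
Proof.
move=> p_gt0 vp; exists (fun q => if q == p then v else 0).
  split=> [q q_gt0|].
    by case: eqVneq => [->//|_]; exact: (weight_space_submod _).1.
  apply: (sub_finite_set (B := [set p])) => // q [_].
  by case: (eqVneq q p) => //; rewrite eqxx.
rewrite /mapF (fsbigE [:: p])//=.
- by rewrite big_mkcond big_seq1 mem_set// eqxx.
- by move=> q /=; rewrite inE => /eqP ->.
- by move=> q _; rewrite inE => /negPf ->; rewrite linear0.
Qed.

Lemma kerE_submod mu : submod_set (kerE mu : set M).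
Proof.
split=> [|a x y [xmu x0] [ymu y0]].
  by split=> [|a n _]; [exact: (weight_space_submod _).1|rewrite linear0].
split=> [|b n n_gt0]; first exact: (weight_space_submod _).2.
by rewrite linearP x0// y0// scaler0 addr0.
Qed.

(** A choice, for each [v] of weight [mu], of a family [s mu v] in M_{delta mu}
    such that F_mu (s mu v) is the component of [v] in im F_mu. The family is
    not unique and does not depend linearly on [v]; only its image does. *)
Lemma ex_ker_im_split : exists s : weight R -> M -> simpleRoot * nat -> M,
  forall mu v, ws mu v ->
    delta_space mu (s mu v) /\ kerE mu (v - mapF (s mu v)).
Proof.
have [|s sP] := choice (X := weight R * M)
    (P := fun muv s => ws muv.1 muv.2 ->
      delta_space muv.1 s /\ kerE muv.1 (muv.2 - mapF s)).
  move=> [mu v] /=.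
  have [vmu|nvmu] := pselect (ws mu v); last by exists (fun=> 0).
  have [/seteqP[+ _] _] := M_X3 mu; move=> /(_ v vmu).
  move=> [u ku [_ [x dx <-] uxv]].
  by exists x => _; split=> //; rewrite -uxv addrK.
by exists (fun mu v => s (mu, v)) => mu v; exact: (sP (mu, v)).
Qed.

Section KernelPart.
Variable s : weight R -> M -> simpleRoot * nat -> M.
Hypothesis sP : forall mu v, ws mu v ->
  delta_space mu (s mu v) /\ kerE mu (v - mapF (s mu v)).

Definition ker_part (mu : weight R) (v : M) : M := v - mapF (s mu v).

Lemma ker_part_unique mu u w :
  kerE mu u -> imF mu w -> ker_part mu (u + w) = u.
Proof.
move=> ku iw.
have uwmu : ws mu (u + w).
  have [/seteqP[_ kiM] _] := M_X3 mu.
  by apply: kiM; exists u => //; exists w.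
have [ds ks] := sP uwmu; apply/eqP; rewrite -subr_eq0; apply/eqP.
have [_ /seteqP[ki0 _]] := M_X3 mu; apply: ki0; split.
  exact (submod_setB (kerE_submod mu) ks ku).
rewrite /ker_part addrAC [u + w - u]addrAC subrr add0r.
by refine (submod_setB (imF_submod mu) iw _); exists (s mu (u + w)).
Qed.

Lemma ker_part_ker mu u : kerE mu u -> ker_part mu u = u.
Proof.
by move=> ku; rewrite -{1}[u]addr0 ker_part_unique//; exact: (imF_submod mu).1.
Qed.

Lemma ker_part_im mu w : imF mu w -> ker_part mu w = 0.
Proof.
by move=> iw; rewrite -[w]add0r ker_part_unique//; exact: (kerE_submod mu).1.
Qed.

Lemma ker_part_lin mu : linear_on (ws mu) (ker_part mu).
Proof.
move=> a x y /sP[dx kx] /sP[dy ky].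
have {1}-> : a *: x + y = (a *: ker_part mu x + ker_part mu y)
    + (a *: mapF (s mu x) + mapF (s mu y)).
  by rewrite addrACA -scalerDr /ker_part !subrK.
apply: ker_part_unique; first exact: (kerE_submod mu).2.
by apply: (imF_submod mu).2; [exists (s mu x)|exists (s mu y)].
Qed.

(** ker E_mu is finitely generated because it is the image of M_mu under the
    projection along im F_mu. *)
Lemma ex_kernel_form : (forall mu, finite_dim M mu) ->
  exists kap : weight R -> M -> M -> K, forall mu,
    [/\ forall u v, kap mu u v = kap mu v u,
        forall u, linear_on (kerE mu) (kap mu u : M -> K^o)
      & forall u, kerE mu u -> (forall v, kerE mu v -> kap mu u v = 0) ->
        u = 0].
Proof.
move=> M_fin; suff /choice[kap kapP] : forall mu, exists k : M -> M -> K,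
    [/\ forall u v, k u v = k v u,
        forall u, linear_on (kerE mu) (k u : M -> K^o)
      & forall u, kerE mu u -> (forall v, kerE mu v -> k u v = 0) -> u = 0].
  by exists kap.
move=> mu; have [r rmu rspan] := M_fin mu.
have rws (i : 'I_(size r)) : ws mu r`_i by apply/rmu/mem_nth.
apply: (ex_nondegenerate_sym (f := fun i : 'I_(size r) => ker_part mu r`_i)).
- exact: kerE_submod.
- by move=> i; have [] := sP (rws i).
move=> v kv; have [k vE] := rspan v kv.1; exists k.
rewrite -[LHS](ker_part_ker kv) {1}vE.
have kr i : ws mu (k i *: r`_i).
  by exact (submod_setZ (weight_space_submod mu) (k i) (rws i)).
have [_ ->] := linear_on_sum (weight_space_submod mu) (@ker_part_lin mu)
  (index_enum _) (P := xpredT) (fun i _ => kr i).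
apply: eq_bigr => i _.
exact (linear_onZ (weight_space_submod mu) (@ker_part_lin mu) _ (rws i)).
Qed.

End KernelPart.
End GradedOperators.

(** * The forms on the weight spaces *)

Section FormRecursion.
Variables (F : archiRealFieldType) (V : vectType F).
Variables (R : rootSystem V) (Pi : rootBasis R) (K : fieldType).
Variables (c : coefficients Pi K) (M : gradedSpace Pi K).

Local Notation simpleRoot := (seq_sub (simple Pi)).
Local Notation ws := (@weight_space _ _ _ Pi K M).
Local Notation Eo p := (opE M p.1 p.2%:Z).
Local Notation Fo p := (opF M p.1 p.2%:Z).
Local Notation depth := (@depth _ _ _ Pi K M).
Local Notation positive := [set p : simpleRoot * nat | (0 < p.2)%N].

Variable s : weight R -> M -> simpleRoot * nat -> M.
Variable kap : weight R -> M -> M -> K.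

(** The form on M_mu for which ker E_mu is orthogonal to im F_mu, equal to the
    chosen form on ker E_mu, and with F_mu adjoint to E_mu:
    (F_mu x, w) = sum over p of (x_p, E_p w). The sum refers to the forms in
    strictly smaller depth. On a weight outside the support the recursive call
    is not always allowed, hence the test. The formula is applied to the
    preimage [s mu v], so neither symmetry nor linearity in [v] is immediate;
    linearity in [w] is. *)
Definition form_step (mu : weight R)
    (rec : forall la, (depth la < depth mu)%N -> M -> M -> K) (v w : M) : K :=
  kap mu (ker_part s mu v) (ker_part s mu w) +
  \sum_(p \in positive)
    if pselect (depth (raise mu p) < depth mu)%N is left lt_p
    then rec _ lt_p (s mu v p) (Eo p w) else 0.

Definition weight_form : weight R -> M -> M -> K :=
  Fix (ltn_measure_wf depth) (fun=> M -> M -> K) form_step.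

Definition form_term mu v w (p : simpleRoot * nat) : K :=
  if (depth (raise mu p) < depth mu)%N
  then weight_form (raise mu p) (s mu v p) (Eo p w) else 0.

Lemma weight_formE mu v w :
  weight_form mu v w = kap mu (ker_part s mu v) (ker_part s mu w) +
    \sum_(p \in positive) form_term mu v w p.
Proof.
rewrite /weight_form Fix_eq => [|la f g fg]; last first.
  have -> // : f = g.
  by apply: functional_extensionality_dep => x; apply/funext => lt_x; apply: fg.
rewrite /form_step; congr (_ + _); apply: eq_fsbigr => p _.
by rewrite /form_term; case: pselect => [->//|/negP/negPf->].
Qed.

Hypotheses (hc : symmetric_coef c) (M_X2 : condX2 c M) (M_X3 : condX3 M).
Hypothesis M_qb : quasi_bounded Pi (in_support M).
Hypothesis sP : forall mu v, ws mu v ->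
  delta_space mu (s mu v) /\ kerE mu (v - mapF (s mu v)).
Hypothesis kapP : forall mu,
  [/\ forall u v, kap mu u v = kap mu v u,
      forall u, linear_on (kerE mu) (kap mu u : M -> K^o)
    & forall u, kerE mu u -> (forall v, kerE mu v -> kap mu u v = 0) ->
        u = 0].

(** The induction statement. In [contravariant_adj] the restriction to the
    support cannot be dropped during the induction: for [mu] outside the support
    it would need bilinearity at [raise mu p], which can have the same depth as
    [mu]. *)
Record contravariant_at (mu : weight R) : Prop := ContravariantAt {
  contravariant_lin : forall v, ws mu v ->
    linear_on (ws mu) (weight_form mu v : M -> K^o);
  contravariant_sym : forall v w, ws mu v -> ws mu w ->
    weight_form mu v w = weight_form mu w v;
  contravariant_adj : in_support M mu -> forall p v w, (0 < p.2)%N ->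
    ws mu v -> ws (raise mu p) w ->
    weight_form mu v (Fo p w) = weight_form (raise mu p) (Eo p v) w;
  contravariant_nondeg : forall v, ws mu v ->
    (forall w, ws mu w -> weight_form mu v w = 0) -> v = 0
}.

Section InductionStep.
Variable mu : weight R.
Hypothesis IH : forall la, (depth la < depth mu)%N -> contravariant_at la.

Lemma below_form0r la v : (depth la < depth mu)%N -> ws la v ->
  weight_form la v 0 = 0.
Proof.
move=> lt_la vla; have /contravariant_lin/(_ v vla) h := IH lt_la.
exact (linear_on0 (weight_space_submod M la) h).
Qed.

Lemma below_form0l la w : (depth la < depth mu)%N -> ws la w ->
  weight_form la 0 w = 0.
Proof.
move=> lt_la wla; rewrite (contravariant_sym (IH lt_la))// ?below_form0r//.
exact: (weight_space_submod M la).1.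
Qed.

Lemma below_sum la v n (d : 'I_n -> K) (u : 'I_n -> M) :
    (depth la < depth mu)%N -> ws la v -> (forall i, ws la (u i)) ->
  weight_form la v (\sum_i d i *: u i) = \sum_i d i * weight_form la v (u i).
Proof.
move=> lt_la vla ula; have /contravariant_lin/(_ v vla) h := IH lt_la.
have wsM := weight_space_submod M la.
have du i : ws la (d i *: u i) by exact (submod_setZ wsM (d i) (ula i)).
have [_ ->] :=
  linear_on_sum wsM h (index_enum _) (P := xpredT) (fun i _ => du i).
by apply: eq_bigr => i _; rewrite (linear_onZ wsM h)//; exact: ula.
Qed.

(** Contravariance in smaller depth holds without restriction to the support,
    and also for [p.2 = 0], where both operators are the identity. *)
Lemma below_adj la p v w : (depth la < depth mu)%N ->
  ws la v -> ws (raise la p) w ->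
  weight_form la v (Fo p w) = weight_form (raise la p) (Eo p v) w.
Proof.
move=> lt_la; case: p => a [|n] /=.
  by rewrite /raise mulr0n addr0 opE0 opF0.
move=> vla wla; have [sla|nsla] := pselect (in_support M la).
  exact: (contravariant_adj (IH lt_la) sla (p := (a, n.+1))).
have -> : v = 0 by exact: not_in_support vla.
have -> : opF M a n.+1 w = 0.
  by apply: (not_in_support nsla); exact: (opF_raise (p := (a, n.+1))).
rewrite linear0 below_form0r ?below_form0l//.
  exact: leq_ltn_trans (depth_raise_le M_qb _ _) lt_la.
exact: (weight_space_submod M la).1.
Qed.

Lemma form_term_eq0 v w p : ws mu v -> ws mu w -> (0 < p.2)%N ->
  s mu v p = 0 -> form_term mu v w p = 0.
Proof.
move=> vmu wmu p_gt0 s0; rewrite /form_term; case: ifP => // lt_p.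
by rewrite s0 below_form0l//; exact: opE_raise.
Qed.

Lemma finite_form_term v w : ws mu v -> ws mu w ->
  finite_set [set p | positive p /\ form_term mu v w p != 0].
Proof.
move=> vmu wmu; have [[_ +] _] := sP vmu; apply: sub_finite_set => p [p_gt0].
by move=> t0; split=> //; apply: contra_neq t0; exact: form_term_eq0.
Qed.

Lemma step_lin v : ws mu v -> linear_on (ws mu) (weight_form mu v : M -> K^o).
Proof.
move=> vmu a x y xmu ymu; rewrite !weight_formE (ker_part_lin M_X3 sP)//.
have [_ kap_lin _] := kapP mu; rewrite kap_lin; first last.
- by have [] := sP ymu.
- by have [] := sP xmu.
have -> : \sum_(p \in positive) form_term mu v (a *: x + y) p =
    \sum_(p \in positive)
      (a *: (form_term mu v x p : K^o) + form_term mu v y p).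
  apply: eq_fsbigr => p /set_mem p_gt0; rewrite /form_term.
  case: ifP => [lt_p|_]; last by rewrite scaler0 addr0.
  have [[/(_ p p_gt0) sp _] _] := sP vmu.
  rewrite linearP (contravariant_lin (IH lt_p) sp)//; exact: opE_raise.
rewrite fsum_lin; try exact: finite_form_term.
by rewrite scalerDr addrACA.
Qed.

Hypothesis mu_supp : in_support M mu.

Lemma depth_raise (p : simpleRoot * nat) :
  (0 < p.2)%N -> (depth (raise mu p) < depth mu)%N.
Proof. exact: depth_raise_lt. Qed.

(** Both sides equal the pairing of E_q' x and E_p' w in the common target
    weight, which is above [raise mu p] and so is covered by the induction
    hypothesis. *)
Lemma form_FE_swap (p q p' q' : simpleRoot * nat) x w :
    (0 < p.2)%N -> (0 < q.2)%N ->
    raise (raise mu p) q' = raise (raise mu q) p' ->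
    ws (raise mu p) x -> ws (raise mu q) w ->
  weight_form (raise mu p) x (Fo q' (Eo p' w)) =
    weight_form (raise mu q) w (Fo p' (Eo q' x)).
Proof.
move=> p_gt0 q_gt0 pqE xp wq.
have lt_p := depth_raise p_gt0; have lt_q := depth_raise q_gt0.
have lt_pq' := leq_ltn_trans (depth_raise_le M_qb (raise mu p) q') lt_p.
have Ex := opE_raise q' xp.
have Ew : ws (raise (raise mu p) q') (Eo p' w) by rewrite pqE; exact: opE_raise.
by rewrite !below_adj -?pqE// (contravariant_sym (IH lt_pq')).
Qed.

(** The operator E_mu F_mu on M_{delta mu} is self-adjoint. For distinct simple
    roots E and F commute; for a single root, (X2) expands both sides into sums
    over the same range whose coefficients c_{mu,a,m,n,k} and c_{mu,a,n,m,k}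
    agree by symmetry, and the terms match by [form_FE_swap]. *)
Lemma form_opEF (p q : simpleRoot * nat) x w :
  (0 < p.2)%N -> (0 < q.2)%N ->
  ws (raise mu p) x -> ws (raise mu q) w ->
  weight_form (raise mu p) x (Eo p (Fo q w)) =
    weight_form (raise mu q) w (Eo q (Fo p x)).
Proof.
case: p q => a m [b n] p_gt0 q_gt0 xp wq.
have [eq_ab|neq_ab] := eqVneq a b; last first.
  have [/(_ neq_ab) -> _] := M_X2 a p_gt0 q_gt0 wq.
  have [] := M_X2 b q_gt0 p_gt0 xp; rewrite eq_sym => /(_ neq_ab) -> _.
  exact: (form_FE_swap (p := (a, m)) (q := (b, n)) (p' := (a, m)) (q' := (b, n))
    p_gt0 q_gt0 (raiseAC _ _ _) xp wq).
case: b / eq_ab in q_gt0 wq *.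
have EFx := opEF_same M_X2 q_gt0 p_gt0 xp; rewrite minnC in EFx.
rewrite (opEF_same M_X2 p_gt0 q_gt0 wq) EFx /=.
have raiseE k : (k < (minn m n).+1)%N ->
    raise (raise mu (a, m)) (a, n - k)%N = raise (raise mu (a, n)) (a, m - k)%N.
  rewrite ltnS leq_min => /andP[km kn]; rewrite /raise -!addrA -!mulrnDr.
  by rewrite !addnBA// addnC.
have FE_ws k : (k < (minn m n).+1)%N ->
    ws (raise mu (a, m)) (opF M a (n - k)%N (opE M a (m - k)%N w)) /\
    ws (raise mu (a, n)) (opF M a (m - k)%N (opE M a (n - k)%N x)).
  move=> /raiseE mnk; split.
    apply: (opF_raise (p := (a, n - k)%N)); rewrite mnk.
    exact: (opE_raise (a, m - k)%N _).
  apply: (opF_raise (p := (a, m - k)%N)); rewrite -mnk.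
  exact: (opE_raise (a, n - k)%N _).
rewrite !below_sum; try exact: depth_raise; try by [];
  try by move=> k; have [] := FE_ws k (ltn_ord k).
apply: eq_bigr => k _; rewrite hc//; congr (_ * _).
exact: (form_FE_swap (p := (a, m)) (q := (a, n)) (p' := (a, m - k)%N)
  (q' := (a, n - k)%N) p_gt0 q_gt0 (raiseE _ (ltn_ord k)) xp wq).
Qed.

Lemma weight_formE_supp v w : weight_form mu v w =
  kap mu (ker_part s mu v) (ker_part s mu w) +
  \sum_(p \in positive) weight_form (raise mu p) (s mu v p) (Eo p w).
Proof.
rewrite weight_formE; congr (_ + _); apply: eq_fsbigr => p /set_mem p_gt0.
by rewrite /form_term depth_raise.
Qed.

Lemma kap0r u : kap mu u 0 = 0.
Proof.
by have [_ + _] := kapP mu => /(_ u) /(linear_on0 (kerE_submod M mu)).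
Qed.

(** With y = s mu v, the left side is the sum over p of (y_p, E_p F_q w), the
    right side is (E_q F_mu y, w) since E_q kills the kernel part of [v]; they
    agree by self-adjointness of E_mu F_mu. *)
Lemma step_adj q v w : (0 < q.2)%N -> ws mu v -> ws (raise mu q) w ->
  weight_form mu v (Fo q w) = weight_form (raise mu q) (Eo q v) w.
Proof.
move=> q_gt0 vmu wq; have lt_q := depth_raise q_gt0.
have [ds [_ ker0]] := sP vmu; have [sws _] := ds.
have Eq_v : Eo q v = Eo q (mapF (s mu v)).
  by apply/eqP; rewrite -subr_eq0 -linearB ker0.
rewrite weight_formE_supp (ker_part_im M_X3 sP (opF_imF q_gt0 wq)) kap0r add0r.
have Eq_ws u : ws mu u -> ws (raise mu q) (Eo q u) by exact: opE_raise.
rewrite Eq_v (contravariant_sym (IH lt_q))//; last first.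
  by rewrite -Eq_v; exact: Eq_ws.
have h_lin :
    linear_on (ws mu) (fun u => weight_form (raise mu q) w (Eo q u) : K^o).
  move=> a x y xmu ymu; rewrite linearP.
  by rewrite (contravariant_lin (IH lt_q) wq)//; exact: Eq_ws.
have Fs_ws p : positive p -> ws mu (Fo p (s mu v p)).
  by move=> p_gt0; apply/opF_raise/sws.
have [_ ->] :=
  linear_on_fsum (weight_space_submod M mu) h_lin Fs_ws (finite_opF ds).
by apply: eq_fsbigr => p /set_mem p_gt0; rewrite form_opEF//; exact: sws.
Qed.

(** Write w = k + F_mu y with k in the kernel. Contravariance turns
    (v, F_mu y) into the sum over q of (E_q v, y_q), which is by symmetry in
    smaller depth the sum that defines (w, v). *)
Lemma step_sym v w : ws mu v -> ws mu w ->
  weight_form mu v w = weight_form mu w v.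
Proof.
move=> vmu wmu; have [ds kw] := sP wmu; have [sws _] := ds.
have [kap_sym _ _] := kapP mu.
have Fs_ws p : positive p -> ws mu (Fo p (s mu w p)).
  by move=> p_gt0; apply/opF_raise/sws.
have [Fws FE] := linear_on_fsum (weight_space_submod M mu) (step_lin vmu) Fs_ws
  (finite_opF ds).
have {1}-> : w = 1 *: ker_part s mu w + mapF (s mu w).
  by rewrite scale1r subrK.
rewrite (step_lin vmu) ?scale1r; [|exact: kw.1|exact: Fws].
rewrite /mapF FE weight_formE_supp (ker_part_ker M_X3 sP kw) kap_sym.
rewrite [X in _ + X + _ = _]fsbig1 ?addr0 => [|p p_gt0]; last first.
  rewrite kw.2// below_form0r//; first exact: depth_raise.
  by have [[+ _] _] := sP vmu; apply.
rewrite weight_formE_supp; congr (_ + _); apply: eq_fsbigr => p /set_mem p_gt0.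
rewrite step_adj//; last exact: sws.
rewrite (contravariant_sym (IH (depth_raise p_gt0)))//; last exact: sws.
exact: opE_raise.
Qed.

(** A vector [v] orthogonal to all F_q w has E_q v orthogonal to M_{mu + q}, so
    E_q v = 0; then [v] lies in ker E_mu, where the form is nondegenerate. *)
Lemma step_nondeg v : ws mu v ->
  (forall w, ws mu w -> weight_form mu v w = 0) -> v = 0.
Proof.
move=> vmu v0; have [_ _ kap_nondeg] := kapP mu.
have kv : kerE mu v.
  split=> // a n n_gt0; have lt_p := depth_raise (p := (a, n)) n_gt0.
  apply: (contravariant_nondeg (IH lt_p)) => [|w wp].
    exact: (opE_raise (a, n)).
  rewrite -(step_adj (q := (a, n)) n_gt0 vmu wp) v0//.
  exact: (opF_raise (p := (a, n))).
apply: kap_nondeg => // u ku; have := v0 u ku.1.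
rewrite weight_formE_supp !(ker_part_ker M_X3 sP)// fsbig1 ?addr0// => p p_gt0.
rewrite ku.2// below_form0r//; first exact: depth_raise.
by have [[+ _] _] := sP vmu; apply.
Qed.

End InductionStep.

Lemma weight_form_contravariant mu : contravariant_at mu.
Proof.
elim/(well_founded_ind (ltn_measure_wf depth)): mu => mu IH.
have [smu|nsmu] := pselect (in_support M mu).
  split; [exact: step_lin|exact: step_sym|by move=> _; exact: step_adj|].
  exact: step_nondeg.
have ws0 v : ws mu v -> v = 0 by exact: not_in_support.
split=> [|v w /ws0 -> /ws0 -> //|//|v /ws0//].
exact: step_lin.
Qed.

End FormRecursion.

(** * The form on the whole module *)

Section GlobalForm.
Variables (F : archiRealFieldType) (V : vectType F).
Variables (R : rootSystem V) (Pi : rootBasis R) (K : fieldType).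
Variable M : gradedSpace Pi K.

Local Notation ws := (@weight_space _ _ _ Pi K M).

(** The homogeneous components of a vector, with the uniqueness from which
    their linearity follows. *)
Lemma ex_homogeneous_parts : exists x : M -> weight R -> M, forall v,
  [/\ forall mu, ws mu (x v mu), finite_set [set mu | x v mu != 0],
      v = \sum_(mu \in [set: weight R]) x v mu
    & forall y : weight R -> M, (forall mu, ws mu (y mu)) ->
        finite_set [set mu | y mu != 0] ->
        v = \sum_(mu \in [set: weight R]) y mu -> y =1 x v].
Proof.
have [x xP] := choice (@component_direct _ _ _ _ _ M); exists x => v.
have [[xmu xfin xsum] xuniq] := xP v; split=> // y ymu yfin ysum mu.
by rewrite (xuniq y).
Qed.

Variable x : M -> weight R -> M.
Hypothesis xP : forall v,
  [/\ forall mu, ws mu (x v mu), finite_set [set mu | x v mu != 0],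
      v = \sum_(mu \in [set: weight R]) x v mu
    & forall y : weight R -> M, (forall mu, ws mu (y mu)) ->
        finite_set [set mu | y mu != 0] ->
        v = \sum_(mu \in [set: weight R]) y mu -> y =1 x v].

Lemma part_ws v mu : ws mu (x v mu).
Proof. by have [+ _ _ _] := xP v. Qed.

Lemma part_lin a u v mu : x (a *: u + v) mu = a *: x u mu + x v mu.
Proof.
have [umu ufin usum _] := xP u; have [vmu vfin vsum _] := xP v.
have [_ _ _ /(_ (fun mu => a *: x u mu + x v mu)) <-//] := xP (a *: u + v).
- by move=> la; apply: (weight_space_submod M la).2.
- have := conj ufin vfin; rewrite -finite_setU; apply: sub_finite_set => la.
  have [u0|u0 _] := eqVneq (x u la) 0; last by left.
  by rewrite /= u0 scaler0 add0r; right.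
rewrite fsum_lin -?usum -?vsum//.
  by apply: sub_finite_set ufin => la [].
by apply: sub_finite_set vfin => la [].
Qed.

Lemma part_hom mu v la : ws mu v -> x v la = if la == mu then v else 0.
Proof.
move=> vmu; have [_ _ _ /(_ (fun la => if la == mu then v else 0)) <-//] := xP v.
- by move=> nu; case: eqP => [->//|_]; exact: (weight_space_submod M nu).1.
- apply: (sub_finite_set (B := [set mu])) => // nu /=.
  by case: (eqVneq nu mu) => //; rewrite eqxx.
rewrite (fsbigE [:: mu])//=; last by move=> nu _; rewrite inE => /negPf ->.
by rewrite big_mkcond big_seq1 in_setT eqxx.
Qed.

Variable b : weight R -> M -> M -> K.
Hypothesis b_lin :
  forall mu v, ws mu v -> linear_on (ws mu) (b mu v : M -> K^o).
Hypothesis b_sym :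
  forall mu v w, ws mu v -> ws mu w -> b mu v w = b mu w v.

(** The orthogonal sum of the forms on the weight spaces. *)
Definition sum_form (v w : M) : K :=
  \sum_(mu \in [set: weight R]) b mu (x v mu) (x w mu).

Lemma sum_form_sym v w : sum_form v w = sum_form w v.
Proof. by apply: eq_fsbigr => mu _; rewrite b_sym//; exact: part_ws. Qed.

Lemma part_form0 mu v : b mu (x v mu) 0 = 0.
Proof. exact (linear_on0 (weight_space_submod M mu) (b_lin (part_ws v mu))). Qed.

Lemma sum_form_lin v a y z :
  sum_form v (a *: y + z) = a * sum_form v y + sum_form v z.
Proof.
have fin w :
    finite_set [set mu | [set: weight R] mu /\ b mu (x v mu) (x w mu) != 0].
  have [_ + _ _] := xP w; apply: sub_finite_set => mu [_].
  by apply: contra_neq => ->; exact: part_form0.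
transitivity (\sum_(mu \in [set: weight R])
    (a *: (b mu (x v mu) (x y mu) : K^o) + b mu (x v mu) (x z mu))).
  by apply: eq_fsbigr => mu _; rewrite part_lin b_lin//; exact: part_ws.
by rewrite fsum_lin.
Qed.

Lemma sum_form_hom mu v w : ws mu w -> sum_form v w = b mu (x v mu) w.
Proof.
move=> wmu; rewrite /sum_form (fsbigE [:: mu])//=.
  by rewrite big_mkcond big_seq1 in_setT (part_hom _ wmu) eqxx.
move=> la _; rewrite inE (part_hom _ wmu) => /negPf ->.
exact: part_form0.
Qed.

Lemma ex_biscalar_sum_form : exists f : {biscalar M}, f =2 sum_form.
Proof.
have sum_form_bilinear : bilinear_for *%R *%R sum_form.
  split=> [w a y z|v a y z]; last exact: sum_form_lin.
  by rewrite ![sum_form _ w]sum_form_sym sum_form_lin.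
pose f : {biscalar M} := HB.pack sum_form
  (bilinear_isBilinear.Build _ _ _ _ _ _ sum_form sum_form_bilinear).
by exists f.
Qed.

End GlobalForm.

Theorem proposition3p7 (F : archiRealFieldType) (V : vectType F)
    (R : rootSystem V) (Pi : rootBasis R) (K : fieldType)
    (c : coefficients Pi K) (hc : symmetric_coef c) (M : objX c) :
  exists b : {biscalar M}, contravariant b /\ nondegenerate_form b.
Proof.
have [M_qb M_fin] := objX1 M; have M_X3 := objX3 M.
have M_X2 : condX2 c M by exact: objX2.
have [s sP] := ex_ker_im_split M_X3.
have [kap kapP] := ex_kernel_form M_X3 sP M_fin.
have formP := weight_form_contravariant hc M_X2 M_X3 M_qb sP kapP.
have [x xP] := ex_homogeneous_parts M.
have form_lin mu := contravariant_lin (formP mu).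
have form_sym mu := contravariant_sym (formP mu).
have [b bE] := ex_biscalar_sum_form xP form_lin form_sym.
have b_sym v w : b v w = b w v by rewrite !bE (sum_form_sym xP form_sym).
have b_hom mu (v w : M) (wmu : weight_space mu w) :
    b v w = weight_form s kap mu (x v mu) w.
  by rewrite bE (sum_form_hom xP form_lin _ wmu).
have part_self mu (v : M) (vmu : weight_space mu v) : x v mu = v.
  by rewrite (part_hom xP _ vmu) eqxx.
have form0l mu (v : M) : weight_space mu v -> weight_form s kap mu 0 v = 0.
  move=> vmu; have wsM := weight_space_submod M mu.
  by rewrite form_sym// ?(linear_on0 wsM (form_lin mu v vmu))//; exact: wsM.1.
have nondeg v : (forall w, b v w = 0) -> v = 0.
  move=> v0; have [_ _ vsum _] := xP v.
  rewrite vsum fsbig1// => mu _.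
  apply: (contravariant_nondeg (formP mu)) => [|w wmu].
    exact: part_ws xP _ _.
  by rewrite -b_hom.
exists b; split; last by split=> // w w0; apply: nondeg => v; rewrite b_sym.
split=> // [la mu v w vla wmu la_mu|mu a n v w n_gt0 vmu wmu].
  by rewrite (b_hom _ _ _ wmu) (part_hom xP _ vla) eq_sym (negPf la_mu) form0l.
have Evmu := opE_raise (a, n) vmu; have Fwmu := opF_raise (p := (a, n)) wmu.
rewrite (b_hom _ _ _ wmu) (b_hom _ _ _ Fwmu).
rewrite (part_self _ _ Evmu) (part_self _ _ vmu).
have [smu|nsmu] := pselect (in_support M mu).
  by rewrite (contravariant_adj (formP mu) smu (p := (a, n))).
have v0 : v = 0 by exact: not_in_support vmu.
by rewrite v0 linear0 (form0l _ _ wmu) (form0l _ _ Fwmu).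
Qed.
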